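(* GNSA is not invariant under invertible linear transformations: there exist point clouds $X=\{x_1,\ldots,x_N\}\subset\mathbb{R}^n$ and $Y=\{y_1,\ldots,y_N\}\subset\mathbb{R}^m$ of the same size and an invertible linear map $A:\mathbb{R}^n\to\mathbb{R}^n$ such that, with $X_A=\{Ax_1,\ldots,Ax_N\}$, one has $\mathrm{GNSA}(X_A,Y)\ne\mathrm{GNSA}(X,Y)$.
   Context: A point cloud of size $N\ge 1$ in $\mathbb{R}^n$ is a family of points $x_1,\ldots,x_N\in\mathbb{R}^n$ indexed by $1,\ldots,N$. $d(\cdot,\cdot)$ is Euclidean distance. For point clouds $X=\{x_1,\ldots,x_N\}\subset\mathbb{R}^n$ and $Y=\{y_1,\ldots,y_N\}\subset\mathbb{R}^m$ of the same size, $$\mathrm{GNSA}(X,Y)=\frac1{N^2}\sum_{1\le i,j\le N}\left|\frac{d(x_i,x_j)}{\max_{x\in X}d(x,0)}-\frac{d(y_i,y_j)}{\max_{y\in Y}d(y,0)}\right|.$$ All point clouds are assumed to contain at least one nonzero point, so that the denominators are nonzero. *)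

(* Defs.v *)
From mathcomp Require Import all_boot all_order all_algebra.
From mathcomp Require Import reals.

Set Implicit Arguments.
Unset Strict Implicit.
Unset Printing Implicit Defensive.

Import Order.TTheory GRing.Theory Num.Theory.
Local Open Scope ring_scope.

(* The norm that MathComp-Analysis puts on matrices is the sup norm, so the
   Euclidean distance is written out. *)
Definition edist (R : realType) (n : nat) (x y : 'cV[R]_n) : R :=
  Num.sqrt (\sum_(k < n) (x k 0 - y k 0) ^+ 2).

(* Since distances are nonnegative, starting the iterated maximum at 0 does not
   change the maximum over a nonempty family. *)
Definition radius (R : realType) (n N : nat) (X : 'I_N -> 'cV[R]_n) : R :=
  \big[Num.max/0]_(i < N) edist (X i) 0.

(* Points may be repeated, so a cloud is an indexed family and not a set. *)
Definition point_cloud (R : realType) (n N : nat) (X : 'I_N -> 'cV[R]_n) : Prop :=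
  (0 < N)%N /\ exists i, X i != 0.

Definition GNSA (R : realType) (n m N : nat)
    (X : 'I_N -> 'cV[R]_n) (Y : 'I_N -> 'cV[R]_m) : R :=
  (N%:R ^+ 2)^-1 *
  \sum_(i < N) \sum_(j < N)
    `| edist (X i) (X j) / radius X - edist (Y i) (Y j) / radius Y |.

(* Main.v *)
Require Import Defs.
From mathcomp Require Import all_boot all_order all_algebra.
From mathcomp Require Import reals.

Import Order.TTheory GRing.Theory Num.Theory.
Local Open Scope ring_scope.

(** Comparing a cloud [X] with itself gives GNSA equal to 0, and GNSA vanishes
    only if all normalised distances agree. The shear fixing [e_0] and sending
    [e_1] to [e_0 + e_1] changes the normalised distance of the cloud
    [e_0, e_1] from [sqrt 2 / 1] to [1 / sqrt 2]. *)

Lemma GNSA_refl (R : realType) (n N : nat) (X : 'I_N -> 'cV[R]_n) :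
  GNSA X X = 0.
Proof.
rewrite /GNSA big1 ?mulr0 // => i _; rewrite big1 // => j _.
by rewrite subrr normr0.
Qed.

(** A double sum of absolute values with a nonzero prefactor can vanish only term by term. *)
Lemma GNSA_eq0 (R : realType) (n m N : nat)
    (X : 'I_N -> 'cV[R]_n) (Y : 'I_N -> 'cV[R]_m) :
  GNSA X Y = 0 ->
  forall i j, edist (X i) (X j) / radius X = edist (Y i) (Y j) / radius Y.
Proof.
move=> /eqP XY0 i j.
(* The index [i] inhabits ['I_N], which forces [0 < N]. *)
have N_neq0 : (N%:R ^+ 2)^-1 != 0 :> R.
  by rewrite invr_eq0 expf_eq0 pnatr_eq0 -lt0n; apply: leq_ltn_trans (ltn_ord i).
move: XY0; rewrite /GNSA mulf_eq0 (negPf N_neq0) /= psumr_eq0; last first.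
  by move=> k _; apply: sumr_ge0.
move=> /allP /(_ i (mem_index_enum i)) /=.
rewrite psumr_eq0 // => /allP /(_ j (mem_index_enum j)) /=.
by rewrite normr_eq0 subr_eq0 => /eqP.
Qed.

Definition shear (R : realType) : 'M[R]_2 := 1%:M + delta_mx 0 1.

(** With [E = delta_mx 0 1], [E *m E = 0] gives [(1 + E)(1 - E) = (1 - E)(1 + E) = 1], so the
    inverse shear is [1 - E]. *)
Lemma shear_bijective (R : realType) : bijective (mulmx (shear R) : 'cV_2 -> 'cV_2).
Proof.
have delta_sq0 : delta_mx 0 1 *m (delta_mx 0 1 : 'M[R]_2) = 0 :> 'M[R]_2.
  exact: mul_delta_mx_0.
exists (mulmx (1%:M - delta_mx 0 1)) => x; rewrite mulmxA /shear.
  by rewrite mulmxDr mulmx1 mulmxBl mul1mx delta_sq0 subr0 subrK mul1mx.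
by rewrite mulmxBr mulmx1 [_ *m delta_mx _ _]mulmxDl mul1mx delta_sq0 addr0 addrK mul1mx.
Qed.

Definition basis_cloud (R : realType) (i : 'I_2) : 'cV[R]_2 := delta_mx i 0.

Lemma point_cloud_basis (R : realType) : point_cloud (basis_cloud R).
Proof.
split=> //; exists 0; apply/eqP => /matrixP /(_ 0 0) /eqP.
by rewrite !mxE eqxx oner_eq0.
Qed.

(** Lets [mxE] read the coordinates of the image points off the matrix, with no matrix product to
    expand. *)
Lemma sheared_basis (R : realType) (i : 'I_2) :
  shear R *m basis_cloud R i = col i (shear R).
Proof. by rewrite colE. Qed.

Lemma edist_basis_cloud (R : realType) :
  edist (basis_cloud R 0) (basis_cloud R 1) = Num.sqrt 2.
Proof.
rewrite /edist !big_ord_recl big_ord0 !mxE /=.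
by rewrite subr0 sub0r sqrrN expr1n addr0.
Qed.

Lemma radius_basis_cloud (R : realType) : radius (basis_cloud R) = 1.
Proof.
rewrite /radius !big_ord_recl big_ord0 /edist !big_ord_recl !big_ord0 !mxE /=.
by rewrite !subr0 expr0n expr1n !(addr0, add0r) sqrtr1 (max_l ler01) maxxx.
Qed.

Lemma edist_sheared_basis (R : realType) :
  edist (shear R *m basis_cloud R 0) (shear R *m basis_cloud R 1) = 1.
Proof.
rewrite !sheared_basis /edist !big_ord_recl big_ord0 !mxE /=.
by rewrite !(addr0, add0r) subrr sqrrN expr0n expr1n add0r sqrtr1.
Qed.

Lemma radius_sheared_basis (R : realType) :
  radius (fun i => shear R *m basis_cloud R i) = Num.sqrt 2.
Proof.
rewrite /radius !big_ord_recl big_ord0 !sheared_basis /edist.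
rewrite !big_ord_recl !big_ord0 !mxE /=.
(* [max_l] absorbs the initial value 0 of the iterated maximum; what remains is the larger of 1 and
   [sqrt (1 + 1)]. *)
rewrite !(subr0, addr0, add0r) expr0n expr1n addr0 sqrtr1 (max_l (sqrtr_ge0 _)).
by rewrite -(natrD _ 1 1) max_r // -[X in X <= _]sqrtr1 ler_sqrt ?ler1n ?ltr0n.
Qed.

Theorem mainTheorem8 (R : realType) :
  exists (N n m : nat) (X : 'I_N -> 'cV[R]_n) (Y : 'I_N -> 'cV[R]_m)
         (A : {linear 'cV[R]_n -> 'cV[R]_n}),
    [/\ point_cloud X, point_cloud Y, bijective A
      & GNSA (fun i => A (X i)) Y <> GNSA X Y].
Proof.
exists 2, 2, 2, (basis_cloud R), (basis_cloud R), (mulmx (shear R)).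
split; [exact: point_cloud_basis.. | exact: shear_bijective |].
rewrite GNSA_refl => /GNSA_eq0 /(_ 0 1) /=.
rewrite edist_sheared_basis edist_basis_cloud radius_basis_cloud.
(* The equality is now [1 / sqrt 2 = sqrt 2]; multiplying by [sqrt 2] yields [1 = 2]. *)
rewrite radius_sheared_basis divr1 => /(congr1 ( *%R (Num.sqrt 2))).
rewrite mul1r divff ?sqrtr_eq0 -?ltNge ?ltr0n // -expr2 sqr_sqrtr ?ler0n //.
by move=> /eqP; rewrite (eqr_nat R 1 2).
Qed.
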